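(* Let $\mathbb{X}$ be a complex Banach space and let $T\in \mathbb{L}(\mathbb{X}, \mathbb{X}^* )$ be bijective. Suppose that $A \in \mathbb{L}(\mathbb{X})$. Then the following are equivalent: (a) for any $x, y \in \mathbb{X}$, $x \perp_T y \iff Ax \perp_T Ay$; (b) $A$ is a scalar multiple of a $T$-isometry.
   Context: $\mathbb{X}^*$ is the dual space of $\mathbb{X}$, $\mathbb{L}(\mathbb{X},\mathbb{X}^* )$ is the set of all bounded linear operators from $\mathbb{X}$ to $\mathbb{X}^*$, and $\mathbb{L}(\mathbb{X})$ is the set of all bounded linear operators on $\mathbb{X}$. For $x,y\in\mathbb{X}$, $x \perp_T y$ means $Tx(y)=0$. An operator $B\in\mathbb{L}(\mathbb{X})$ is a $T$-isometry if $T=B^*TB$, where $B^*:\mathbb{X}^*\to\mathbb{X}^*$, $B^*f=f\circ B$, is the (Banach space) adjoint of $B$. Scalars are complex.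
   Formalization: In (b), ''scalar multiple'' is taken to mean nonzero scalar multiple, since A = 0 is the zero multiple of the identity, a T-isometry, but fails (a) whenever the space is nonzero. *)

(* Defs.v *)
From HB Require Import structures.
From mathcomp Require Import all_boot all_order all_algebra.
From mathcomp Require Import all_classical all_reals all_analysis.
From mathcomp Require Import complex.

Set Implicit Arguments.
Unset Strict Implicit.
Unset Printing Implicit Defensive.

Import Order.TTheory GRing.Theory Num.Theory.
Import numFieldNormedType.Exports.

Local Open Scope classical_set_scope.
Local Open Scope complex_scope.
Local Open Scope ring_scope.

(* The complex field is [R[i]] for [R : realType].  Its norm, and hence the
   norm of a [normedModType R[i]], takes values in [R[i]] itself; these values
   are nonnegative, hence real. *)

Section bounded_linear_operators.
Variables (R : realType) (X Y : normedModType R[i]).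

Definition bounded_linear : {pred X -> Y} :=
  mem [set f : X -> Y | linear f /\
                        exists M : R, forall x, `|f x| <= M%:C * `|x| ].

Record blin := BLin { blin_fun :> X -> Y; _ : blin_fun \in bounded_linear }.

HB.instance Definition _ := [isSub for blin_fun].
HB.instance Definition _ := [Choice of blin by <:].

Lemma bounded_linear_submod_closed : submod_closed bounded_linear.
Proof.
split=> [|a f g].
  rewrite inE /=; split.
    by move=> a x y; rewrite scaler0 addr0.
  by exists 0 => x; rewrite normr0 mul0r.
rewrite !inE /= => -[lf [M fM]] [lg [N gN]]; split.
  move=> b x y; rewrite !fctE lf lg !scalerDr !scalerA (mulrC a b).
  by rewrite addrACA.
exists (complex.Re `|a| * M + N) => x; rewrite !fctE (le_trans (ler_normD _ _))//.
rewrite normrZ rmorphD rmorphM/= (RRe_real (normr_real a)) mulrDl lerD//.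
by rewrite -mulrA ler_wpM2l.
Qed.

HB.instance Definition _ :=
  GRing.isSubmodClosed.Build R[i] (X -> Y) bounded_linear
    bounded_linear_submod_closed.
HB.instance Definition _ := [SubChoice_isSubLmodule of blin by <:].

Lemma blin_linear (f : blin) : linear f.
Proof. by case: f => f /= /[!inE] -[]. Qed.

HB.instance Definition _ (f : blin) :=
  GRing.isLinear.Build R[i] X Y _ (blin_fun f) (blin_linear f).

Lemma blin_bounded (f : blin) : exists M : R, forall x, `|f x| <= M%:C * `|x|.
Proof. by case: f => f /= /[!inE] -[]. Qed.

Lemma blinP (f g : blin) : (forall x, f x = g x) -> f = g.
Proof. by move=> fg; apply/val_inj/funext. Qed.

Lemma blin0E x : (0 : blin) x = 0. Proof. by []. Qed.
Lemma blinDE (f g : blin) x : (f + g) x = f x + g x. Proof. by []. Qed.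
Lemma blinZE (c : R[i]) (f : blin) x : (c *: f) x = c *: f x.
Proof. by []. Qed.

Definition opnorm (f : blin) : R[i] :=
  (sup [set complex.Re `|f x| | x in [set x : X | `|x| <= 1]])%:C.

Lemma Re_normE (V : normedModType R[i]) (v : V) : (complex.Re `|v|)%:C = `|v|.
Proof. exact: RRe_real (normr_real v). Qed.

Lemma opnorm_has_sup (f : blin) :
  has_sup [set complex.Re `|f x| | x in [set x : X | `|x| <= 1]].
Proof.
split; first by exists (complex.Re `|f 0|), 0 => //=; rewrite normr0.
have [M fM] := blin_bounded f; exists `|M| => _ [x /= x1 <-].
rewrite -lecR Re_normE (le_trans (fM x))//.
apply: (@le_trans _ _ (`|M|%:C * `|x|)).
  by rewrite ler_wpM2r// lecR ler_norm.
by rewrite -[leRHS]mulr1 ler_wpM2l// lecR.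
Qed.

Lemma opnorm_ge0 (f : blin) : 0 <= opnorm f.
Proof.
rewrite /opnorm (_ : 0 = 0%:C)// lecR.
apply: (@le_trans _ _ (complex.Re `|f 0|)).
  by rewrite linear0 normr0.
apply: ub_le_sup; first exact: (opnorm_has_sup f).2.
by exists 0 => //=; rewrite normr0.
Qed.

Lemma le_opnorm (f : blin) x : `|f x| <= opnorm f * `|x|.
Proof.
have [->|x0] := eqVneq x 0; first by rewrite linear0 !normr0 mulr0.
rewrite -ler_pdivrMr ?normr_gt0// mulrC.
have -> : `|x|^-1 * `|f x| = `|f (`|x|^-1 *: x)|.
  by rewrite linearZ/= normrZ normfV normr_id.
rewrite -Re_normE /opnorm lecR; apply: ub_le_sup.
  exact: (opnorm_has_sup f).2.
by exists (`|x|^-1 *: x) => //=; rewrite normfZV.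
Qed.

Lemma opnorm_le (f : blin) (M : R[i]) : 0 <= M ->
  (forall x, `|f x| <= M * `|x|) -> opnorm f <= M.
Proof.
move=> M0 fM; rewrite -(RRe_real (ger0_real M0)) /opnorm lecR.
apply: ge_sup; first exact: (opnorm_has_sup f).1.
move=> _ [x /= x1 <-]; rewrite -lecR Re_normE (RRe_real (ger0_real M0)).
by rewrite (le_trans (fM x))// -[leRHS]mulr1 ler_wpM2l.
Qed.

Lemma opnormD (f g : blin) : opnorm (f + g) <= opnorm f + opnorm g.
Proof.
apply: opnorm_le; first by rewrite addr_ge0// opnorm_ge0.
by move=> x; rewrite mulrDl (le_trans (ler_normD _ _))// lerD// le_opnorm.
Qed.

Lemma opnormZ_le c (f : blin) : opnorm (c *: f) <= `|c| * opnorm f.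
Proof.
apply: opnorm_le; first by rewrite mulr_ge0// opnorm_ge0.
by move=> x; rewrite blinZE normrZ -mulrA ler_wpM2l// le_opnorm.
Qed.

Lemma opnorm0_eq0 (f : blin) : opnorm f = 0 -> f = 0.
Proof.
move=> f0; apply: blinP => x; apply/eqP; rewrite -normr_le0.
by have := le_opnorm f x; rewrite f0 mul0r.
Qed.

Lemma opnormZ c (f : blin) : opnorm (c *: f) = `|c| * opnorm f.
Proof.
have [->|c0] := eqVneq c 0.
  apply/eqP; rewrite eq_le opnormZ_le/= normr0 mul0r; exact: opnorm_ge0.
apply/eqP; rewrite eq_le opnormZ_le/= mulrC -ler_pdivlMr ?normr_gt0//.
rewrite -[X in opnorm X <= _](scalerK c0) mulrC -normfV; exact: opnormZ_le.
Qed.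

HB.instance Definition _ :=
  Lmodule_isNormed.Build R[i] blin opnormD opnormZ opnorm0_eq0.

Lemma le_blin_norm (f : blin) x : `|f x| <= `|f| * `|x|.
Proof. exact: le_opnorm. Qed.

Lemma blin_norm_le (f : blin) (M : R[i]) : 0 <= M ->
  (forall x, `|f x| <= M * `|x|) -> `|f| <= M.
Proof. exact: opnorm_le. Qed.

End bounded_linear_operators.

Notation "''L' ( X , Y )" := (blin X Y)
  (at level 8, format "''L' ( X ,  Y )") : type_scope.

Notation dual X := (blin X (_[i])^o).

Section composition.
Variables (R : realType) (X Y Z : normedModType R[i]).

Lemma blin_comp_subproof (g : 'L(Y, Z)) (f : 'L(X, Y)) :
  (g \o f) \in @bounded_linear R X Z.
Proof.
rewrite inE; split=> [a x y|] /=; first by rewrite !linearP.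
exists (complex.Re (`|g| * `|f|)) => x /=.
have gf0 : 0 <= `|g| * `|f| by rewrite mulr_ge0.
rewrite (RRe_real (ger0_real gf0)) (le_trans (le_blin_norm _ _))//.
by rewrite -mulrA ler_wpM2l// le_blin_norm.
Qed.

Definition blin_comp (g : 'L(Y, Z)) (f : 'L(X, Y)) : 'L(X, Z) :=
  BLin (blin_comp_subproof g f).

End composition.

Section adjoint.
Variables (R : realType) (X Y : normedModType R[i]).

Lemma adjoint_subproof (B : 'L(X, Y)) :
  (fun f : dual Y => blin_comp f B : dual X) \in
    @bounded_linear R (dual Y) (dual X).
Proof.
rewrite inE; split=> [a f g|]; first exact: blinP.
exists (complex.Re `|B|) => f.
rewrite Re_normE mulrC; apply: blin_norm_le => [|x /=].
  by rewrite mulr_ge0.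
by rewrite (le_trans (le_blin_norm _ _))// -mulrA ler_wpM2l// le_blin_norm.
Qed.

Definition adjoint (B : 'L(X, Y)) : 'L(dual Y, dual X) :=
  BLin (adjoint_subproof B).

Lemma adjointE (B : 'L(X, Y)) (f : dual Y) x : adjoint B f x = f (B x).
Proof. by []. Qed.

End adjoint.

Section T_orthogonality.
Variables (R : realType) (X : normedModType R[i]) (T : 'L(X, dual X)).

Definition T_orthogonal (x y : X) : Prop := T x y = 0.

Definition T_isometry (B : 'L(X, X)) : Prop :=
  T = blin_comp (adjoint B) (blin_comp T B).

End T_orthogonality.

(* Main.v *)
(* Condition (a) says that the functionals [T x] and [S x], with [S = A^* T A],
   have the same kernel for every [x], so [S x] is a scalar multiple of [T x].
   Since [T] is injective and linear, the scalar does not depend on [x], i.e.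
   [S = a T] with [a != 0], and dividing [A] by a square root of [a] gives a
   [T]-isometry. *)
Require Import Defs.
From mathcomp Require Import all_boot all_order all_algebra.
From mathcomp Require Import all_classical all_reals all_analysis.
From mathcomp Require Import complex.

Set Implicit Arguments.
Unset Strict Implicit.
Unset Printing Implicit Defensive.

Import Order.TTheory GRing.Theory Num.Theory.
Import numFieldNormedType.Exports.

Local Open Scope ring_scope.
Local Open Scope complex_scope.

(** If [f y != 0], then [x - (f x / f y) *: y] lies in the kernel of [f], hence in that of [g],
    which forces the factor [g y / f y]. *)
Lemma linear_form_multiple (K : fieldType) (V : lmodType K)
    (f g : {linear V -> K^o}) :
  (forall x, f x = 0 -> g x = 0) -> exists a : K, forall x, g x = a * f x.
Proof.
move=> fg; have [f0|/existsNP[y /eqP fy0]] := pselect (forall x, f x = 0).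
  by exists 0 => x; rewrite mul0r fg.
exists (g y / f y) => x.
have /fg : f (x - (f x / f y) *: y) = 0.
  by rewrite linearB linearZ /= /GRing.scale /= divfK // subrr.
rewrite linearB linearZ /= /GRing.scale /= => /eqP.
by rewrite subr_eq0 => /eqP ->; rewrite mulrC mulrA mulrAC.
Qed.

(** Fix [x != 0]. Comparing the scalars [a], [b], [c] at [x], [y], [x + y], injectivity of [T] gives
    [(c - a) *: x + (c - b) *: y = 0]. *)
Lemma linear_pointwise_multiple (K : fieldType) (V W : lmodType K)
    (S T : {linear V -> W}) :
  injective T -> (forall x, exists a : K, S x = a *: T x) ->
  exists a : K, forall x, S x = a *: T x.
Proof.
move=> T_inj ST; have T0 v : T v = 0 -> v = 0.
  by move=> Tv0; apply: T_inj; rewrite Tv0 linear0.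
have [x0|/existsNP[x /eqP x0]] := pselect (forall x : V, x = 0).
  by exists 0 => x; rewrite (x0 x) !linear0.
have [a Sx] := ST x; exists a => y.
have [b Sy] := ST y; have [c Sxy] := ST (x + y).
have /T0 /eqP : T ((c - a) *: x + (c - b) *: y) = 0.
  rewrite linearD !linearZ /= !scalerBl addrACA -scalerDr -linearD -Sxy.
  by rewrite linearD Sx Sy -opprD subrr.
have [cb|cb] := eqVneq c b.
  rewrite cb subrr scale0r addr0 scaler_eq0 (negPf x0) orbF subr_eq0.
  by rewrite Sy => /eqP ->.
(* As [c != b], [y] is a multiple of [x] and inherits the scalar [a] by linearity. *)
rewrite addrC addr_eq0 -scaleNr => /eqP /(canRL (scalerK _)) -> //.
  by rewrite scalerA !linearZ /= Sx !scalerA mulrC.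
by rewrite subr_eq0.
Qed.

(** The form is bilinear, not sesquilinear, so the factor is a square without conjugation. *)
Lemma form_scale (R : realType) (X : normedModType R[i]) (T : 'L(X, dual X))
    (c : R[i]) (x y : X) :
  T (c *: x) (c *: y) = c ^+ 2 * T x y.
Proof. by rewrite linearZ /= linearZ /= -[LHS]/(c * (c * T x y)) mulrA -expr2. Qed.

(* The scalar in (b) is nonzero: for [A = 0] and [X] nontrivial, (a) fails
   because [T <> 0]. *)
Theorem theorem2p15 (R : realType) (X : completeNormedModType R[i])
    (T : 'L(X, dual X)) (T_bij : bijective T) (A : 'L(X, X)) :
  (forall x y : X, T_orthogonal T x y <-> T_orthogonal T (A x) (A y)) <->
  (exists (c : R[i]) (B : 'L(X, X)),
     [/\ c != 0, T_isometry T B & A = c *: B]).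
Proof.
split=> [AT|[c [B [c0 TB ->]]] x y]; last first.
  rewrite /T_orthogonal {1}TB form_scale.
  split=> [/= ->|/eqP]; first by rewrite mulr0.
  by rewrite mulf_eq0 expf_eq0 (negPf c0) => /eqP.
have T_inj := bij_inj T_bij.
pose S : 'L(X, dual X) := blin_comp (adjoint A) (blin_comp T A).
have [a Sa] : exists a, forall x, S x = a *: T x.
  apply: linear_pointwise_multiple => // x.
  have [a Sx] : exists a, forall y, S x y = a * T x y.
    by apply: linear_form_multiple => y /AT.
  by exists a; apply: blinP => y; rewrite Sx.
have [b b0 Tb] : exists2 b, b != 0 & forall x y, T (A x) (A y) = b * T x y.
  have Sb x y : T (A x) (A y) = a * T x y.
    by rewrite -[LHS]/(S x y) Sa.
  have [a0|] := eqVneq a 0; last by exists a.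
  (* If [a = 0], all [A x], [A y] are [T]-orthogonal, so (a) makes the form vanish and any nonzero
     factor serves. *)
  have T0 x y : T x y = 0 by apply/AT; rewrite /T_orthogonal Sb a0 mul0r.
  by exists 1; [exact: oner_neq0 | move=> x y; rewrite !T0 mulr0].
(* Dividing [A] by a complex square root of [b] divides the form by [b]. *)
have c0 : sqrtC b != 0 by rewrite sqrtC_eq0.
exists (sqrtC b), ((sqrtC b)^-1 *: A); split=> //; last by rewrite scalerKV.
apply: blinP => x; apply: blinP => y /=.
by rewrite form_scale Tb exprVn sqrtCK mulKf.
Qed.
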